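(* For every $x>0$ and every $0\leq r\leq 1$, $$S(x)^r\geq S(x^r),$$ where $S$ denotes Specht's ratio.
   Context: Specht's ratio is the function $S:(0,\infty)\to(0,\infty)$ defined by $$S(x)=\frac{x^{\frac{1}{x-1}}}{e\,\log\left(x^{\frac{1}{x-1}}\right)}\quad (x>0,\ x\neq 1),\qquad S(1)=1,$$ where $\log$ is the natural logarithm (the value $S(1)=1$ is the limit of $S(x)$ as $x\to 1$). *)

(* Defs.v *)
From Stdlib Require Import Reals.
Open Scope R_scope.

(* Only the values at [x > 0] are meaningful: [Rpower x y] is [exp (y * ln x)],
   and [ln] is the constant 0 on nonpositive arguments. *)
Definition Specht (x : R) : R :=
  if Req_dec_T x 1 then 1
  else Rpower x (1 / (x - 1)) / (exp 1 * ln (Rpower x (1 / (x - 1)))).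

(* Main.v *)
Require Import Defs.
From Stdlib Require Import Reals Lra.
From Coquelicot Require Import Coquelicot.
Open Scope R_scope.

(** With [x = exp (2 s)], [ln (S x) = s coth s - 1 + ln (sinh s / s) =: g s],
    which is even in [s]; so the claim is [g (r s) <= r g s] for [s > 0], i.e.
    that [h s := g s / s] is nondecreasing.  Now [s^2 h' s] equals
    [k s := s coth s - (s / sinh s)^2 - ln (sinh s / s)], which tends to [0] at
    [0], and [s sinh^3 s k' s = sinh^3 s - 3 s^2 sinh s + 2 s^3 cosh s] is at
    least [(sinh s - s)^2 (sinh s + 2 s) >= 0] because [cosh s >= 1]. *)

Lemma nondecreasing_of_derive_nonneg (f df : R -> R) (a b : R) :
  a <= b ->
  (forall x, a <= x <= b -> is_derive f x (df x)) ->
  (forall x, a <= x <= b -> 0 <= df x) ->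
  f a <= f b.
Proof.
  intros hab hd hpos.
  destruct (MVT_gen f a b df) as [c [hc e]].
  - intros x hx. rewrite Rmin_left, Rmax_right in hx by lra. apply hd; lra.
  - intros x hx. rewrite Rmin_left, Rmax_right in hx by lra.
    apply continuity_pt_filterlim, (ex_derive_continuous f x).
    exists (df x); apply hd; lra.
  - rewrite Rmin_left, Rmax_right in hc by lra.
    assert (0 <= df c) by (apply hpos; lra). nra.
Qed.

Lemma cosh2_sinh2 (x : R) : cosh x * cosh x = 1 + sinh x * sinh x.
Proof.
  assert (e : exp x * exp (- x) = 1)
    by (rewrite <- exp_plus, Rplus_opp_r; apply exp_0).
  unfold cosh, sinh; nra.
Qed.

Lemma cosh_ge_1 (x : R) : 1 <= cosh x.
Proof.
  assert (h := cosh2_sinh2 x).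
  assert (0 < cosh x)
    by (unfold cosh; assert (H1 := exp_pos x); assert (H2 := exp_pos (- x)); lra).
  nra.
Qed.

Lemma sinh_ge_id (x : R) : 0 <= x -> x <= sinh x.
Proof.
  intros hx.
  assert (h : sinh 0 - 0 <= sinh x - x).
  { apply (nondecreasing_of_derive_nonneg
             (fun y => sinh y - y) (fun y => cosh y - 1)); [lra | |].
    - intros y _. auto_derive; [easy | ring].
    - intros y _. assert (h := cosh_ge_1 y); lra. }
  rewrite sinh_0 in h; lra.
Qed.

(** The difference vanishes at [0] and has derivative [y * sinh y]. *)
Lemma sinh_le_mul_cosh (x : R) : 0 <= x -> sinh x <= x * cosh x.
Proof.
  intros hx.
  assert (h : 0 * cosh 0 - sinh 0 <= x * cosh x - sinh x).
  { apply (nondecreasing_of_derive_nonneg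
             (fun y => y * cosh y - sinh y) (fun y => y * sinh y)); [lra | |].
    - intros y _. auto_derive; [easy | ring].
    - intros y hy. assert (h := sinh_ge_id y); nra. }
  rewrite sinh_0 in h; lra.
Qed.

Lemma cosh_le_exp (x : R) : 0 <= x -> cosh x <= exp x.
Proof.
  intros hx. assert (h := sinh_ge_id x hx).
  unfold cosh; unfold sinh in h; lra.
Qed.

Definition g (s : R) : R := s * cosh s / sinh s - 1 + (ln (sinh s) - ln s).

Definition h (s : R) : R := cosh s / sinh s - 1 / s + (ln (sinh s) - ln s) / s.

Definition k (s : R) : R :=
  s * cosh s / sinh s - (s / sinh s) ^ 2 - (ln (sinh s) - ln s).

Lemma is_derive_k (s : R) : 0 < s ->
  is_derive k s
    ((sinh s ^ 3 - 3 * s ^ 2 * sinh s + 2 * s ^ 3 * cosh s) / (s * sinh s ^ 3)).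
Proof.
  intros hs. assert (hS := sinh_ge_id s (Rlt_le _ _ hs)).
  unfold k. auto_derive.
  - repeat split; lra.
  (* [field] alone cannot use [cosh2_sinh2]: the difference of the two sides is first normalised to
     expose [cosh s ^ 2]. *)
  - apply Rminus_diag_uniq. field_simplify; [|lra].
    replace (cosh s ^ 2) with (1 + sinh s * sinh s)
      by (rewrite <- cosh2_sinh2; ring).
    field; lra.
Qed.

Lemma k_nondecreasing (a b : R) : 0 < a -> a <= b -> k a <= k b.
Proof.
  intros ha hab.
  eapply nondecreasing_of_derive_nonneg;
    [exact hab | intros x hx; apply is_derive_k; lra | intros x hx; cbv beta].
  assert (hS := sinh_ge_id x ltac:(lra)). assert (hC := cosh_ge_1 x).
  apply Rdiv_le_0_compat.
  (* The numerator is exactly this product plus twice the next one. *)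
  - assert (0 <= (sinh x - x) ^ 2 * (sinh x + 2 * x))
      by (apply Rmult_le_pos; [apply pow2_ge_0 | lra]).
    assert (0 <= x ^ 3 * (cosh x - 1))
      by (apply Rmult_le_pos; [apply pow_le |]; lra).
    nra.
  - apply Rmult_lt_0_compat; [lra | apply pow_lt; lra].
Qed.

(** A crude bound that stands in for the limit of [k] at [0]. It adds up [s coth s >= 1],
    [(s / sinh s)^2 <= 1] and [ln (sinh s / s) <= s], the last because
    [sinh s <= s cosh s <= s exp s]. *)
Lemma k_ge_opp (s : R) : 0 < s -> - s <= k s.
Proof.
  intros hs. assert (hS := sinh_ge_id s (Rlt_le _ _ hs)).
  assert (hC := sinh_le_mul_cosh s (Rlt_le _ _ hs)).
  assert (hE := cosh_le_exp s (Rlt_le _ _ hs)).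
  assert (h1 : 1 <= s * cosh s / sinh s) by (apply Rle_div_r; lra).
  assert (h2 : 0 <= s / sinh s <= 1).
  { split; [apply Rdiv_le_0_compat; lra | apply Rle_div_l; lra]. }
  assert (h3 : ln (sinh s) <= ln s + s).
  { rewrite <- (ln_exp s) at 3. rewrite <- ln_mult; [| lra | apply exp_pos].
    apply ln_le; [lra | nra]. }
  unfold k; nra.
Qed.

Lemma k_nonneg (s : R) : 0 < s -> 0 <= k s.
Proof.
  intros hs. apply Rnot_lt_le; intros hneg.
  (* If [k s < 0], then [e <= s] gives [k e <= k s] by monotonicity, while [e <= - k s / 2] gives
     [k e >= - e >= k s / 2 > k s]. *)
  set (e := Rmin s (- k s / 2)).
  assert (he : 0 < e) by (apply Rmin_glb_lt; lra).
  assert (h1 : e <= s) by apply Rmin_l.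
  assert (h2 : e <= - k s / 2) by apply Rmin_r.
  assert (h3 := k_ge_opp e he). assert (h4 := k_nondecreasing e s he h1). lra.
Qed.

Lemma is_derive_h (s : R) : 0 < s -> is_derive h s (k s / s ^ 2).
Proof.
  intros hs. assert (hS := sinh_ge_id s (Rlt_le _ _ hs)).
  unfold h, k. auto_derive.
  - repeat split; lra.
  - apply Rminus_diag_uniq. field_simplify; [|lra].
    replace (cosh s ^ 2) with (1 + sinh s * sinh s)
      by (rewrite <- cosh2_sinh2; ring).
    field; lra.
Qed.

Lemma g_mul_le (r s : R) : 0 < s -> 0 < r <= 1 -> g (r * s) <= r * g s.
Proof.
  intros hs hr.
  assert (hrs : 0 < r * s) by nra.
  assert (hg : forall t, 0 < t -> g t = t * h t).
  { intros t ht. assert (hS := sinh_ge_id t (Rlt_le _ _ ht)).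
    unfold g, h; field; lra. }
  assert (hh : h (r * s) <= h s).
  { eapply nondecreasing_of_derive_nonneg;
      [nra | intros x hx; apply is_derive_h; lra | intros x hx; cbv beta].
    apply Rdiv_le_0_compat; [apply k_nonneg; lra | apply pow_lt; lra]. }
  rewrite !hg by assumption. nra.
Qed.

(** For [x = exp t] and [u = t / (exp t - 1)], the power [x^(1/(x-1))] is [exp u], so
    [ln (S x) = u - 1 - ln u]. The quotient is meaningless at [t = 0], that is, at [x = 1]. *)
Definition ln_Specht_exp (t : R) : R :=
  t / (exp t - 1) - 1 - ln (t / (exp t - 1)).

Lemma div_exp_sub1_pos (t : R) : t <> 0 -> 0 < t / (exp t - 1).
Proof.
  intros ht. destruct (Rdichotomy _ _ ht) as [hn | hp].
  - assert (exp t < 1) by (rewrite <- exp_0; apply exp_increasing; lra).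
    replace (t / (exp t - 1)) with ((- t) / (1 - exp t)) by (field; lra).
    apply Rdiv_lt_0_compat; lra.
  - assert (1 < exp t) by (rewrite <- exp_0; apply exp_increasing; lra).
    apply Rdiv_lt_0_compat; lra.
Qed.

Lemma exp_neq_1 (t : R) : t <> 0 -> exp t <> 1.
Proof. intros ht e. apply ht, exp_inv. now rewrite exp_0. Qed.

Lemma Specht_exp (t : R) : t <> 0 -> Specht (exp t) = exp (ln_Specht_exp t).
Proof.
  intros ht. assert (hu := div_exp_sub1_pos t ht). assert (he := exp_neq_1 t ht).
  unfold Specht. destruct (Req_dec_T (exp t) 1) as [e | _]; [contradiction |].
  unfold Rpower. rewrite !ln_exp.
  replace (1 / (exp t - 1) * t) with (t / (exp t - 1)) by (field; lra).
  replace (ln_Specht_exp t)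
    with (t / (exp t - 1) + - (1) + - ln (t / (exp t - 1)))
    by (unfold ln_Specht_exp; ring).
  rewrite !exp_plus, !exp_Ropp, exp_ln by assumption.
  assert (h1 := exp_pos 1). field; repeat split; lra.
Qed.

(** This is the symmetry [S (1/x) = S x]. Replacing [t] by [- t] turns [u = t / (exp t - 1)] into
    [u * exp t = u + t], so [u] and [ln u] both grow by [t]. *)
Lemma ln_Specht_exp_opp (t : R) : t <> 0 -> ln_Specht_exp (- t) = ln_Specht_exp t.
Proof.
  intros ht. assert (hu := div_exp_sub1_pos t ht). assert (he := exp_neq_1 t ht).
  assert (hp := exp_pos t). unfold ln_Specht_exp.
  replace (- t / (exp (- t) - 1)) with (t / (exp t - 1) * exp t)
    by (rewrite exp_Ropp; field; repeat split; lra).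
  rewrite ln_mult, ln_exp by assumption. field; lra.
Qed.

(** Here [u = s exp (- s) / sinh s = s coth s - s] and [ln u = ln s - ln (sinh s) - s]; the two
    terms [- s] cancel in [u - 1 - ln u]. *)
Lemma ln_Specht_exp_double (s : R) : 0 < s -> ln_Specht_exp (2 * s) = g s.
Proof.
  intros hs. assert (hS := sinh_ge_id s (Rlt_le _ _ hs)).
  assert (hp := exp_pos s).
  assert (hd : exp (2 * s) - 1 = 2 * sinh s * exp s).
  { replace (2 * s) with (s + s) by ring.
    rewrite exp_plus. unfold sinh. rewrite exp_Ropp. field; lra. }
  assert (hc : cosh s - sinh s = / exp s)
    by (unfold cosh, sinh; rewrite exp_Ropp; field; lra).
  unfold ln_Specht_exp, g. rewrite hd.
  replace (2 * s / (2 * sinh s * exp s)) with (s / (sinh s * exp s))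
    by (field; lra).
  rewrite ln_div, ln_mult, ln_exp by nra.
  replace (s / (sinh s * exp s)) with (s * (cosh s - sinh s) / sinh s)
    by (rewrite hc; field; lra).
  field; lra.
Qed.

Lemma ln_Specht_exp_mul_le (r t : R) :
  t <> 0 -> 0 < r <= 1 -> ln_Specht_exp (r * t) <= r * ln_Specht_exp t.
Proof.
  intros ht hr.
  assert (hpos : forall u, 0 < u -> ln_Specht_exp (r * u) <= r * ln_Specht_exp u).
  { intros u hu. replace u with (2 * (u / 2)) by field.
    replace (r * (2 * (u / 2))) with (2 * (r * (u / 2))) by field.
    rewrite !ln_Specht_exp_double by nra. apply g_mul_le; lra. }
  (* Negative [t] reduces to [- t] by evenness. *)
  destruct (Rdichotomy _ _ ht) as [hn | hp]; [| now apply hpos].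
  rewrite <- (ln_Specht_exp_opp t), <- (ln_Specht_exp_opp (r * t)) by nra.
  replace (- (r * t)) with (r * - t) by ring. apply hpos; lra.
Qed.

Lemma Specht_1 : Specht 1 = 1.
Proof. unfold Specht. destruct (Req_dec_T 1 1); [reflexivity | contradiction]. Qed.

Theorem theorem2p7 (x r : R) (hx : 0 < x) (hr : 0 <= r <= 1) :
  Rpower (Specht x) r >= Specht (Rpower x r).
Proof.
  (* When [r = 0] or [x = 1], the exponent [r * ln x] is [0], which [Specht_exp] excludes; both
     sides are then [1]. *)
  destruct (Req_dec r 0) as [-> | hr0].
  { unfold Rpower. rewrite !Rmult_0_l, exp_0, Specht_1. lra. }
  destruct (Req_dec x 1) as [-> | hx1].
  { rewrite Specht_1. unfold Rpower. rewrite ln_1, Rmult_0_r, exp_0, Specht_1. lra. }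
  assert (ht : ln x <> 0) by (apply ln_neq_0; assumption).
  (* Both arguments of [Specht] become exponentials, of [ln x] and of [r * ln x], so that logarithms
     can be compared. *)
  rewrite <- (exp_ln x hx) at 1. unfold Rpower.
  rewrite !Specht_exp, ln_exp by nra.
  apply Rle_ge, Rnot_lt_le; intros hlt%exp_lt_inv.
  assert (hle := ln_Specht_exp_mul_le r (ln x) ht ltac:(lra)). lra.
Qed.
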